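(* Let $N\in\mathbb N$, $\delta=1/N$. For any two positive solutions $\rho$ and $\eta$ to $$\dot\rho_\kappa=-2\,\Delta^\delta_\kappa\Big(\frac{\sqrt{\rho_+\rho_-}-\rho}{\delta^2}\Big)\qquad(\kappa\in[N]),$$ their discretized Hellinger distance $$\mathbb H^\delta(\rho(t),\eta(t)):=\Big(\delta\sum_{\kappa\in[N]}\big|\sqrt{\rho_\kappa(t)}-\sqrt{\eta_\kappa(t)}\big|^2\Big)^{1/2}$$ is non-increasing in time.
   Context: $[N]=\mathbb Z/N\mathbb Z$ with cyclic indices. For $f:[N]\to\mathbb R$: $(f_\pm)_\kappa=f_{\kappa\pm1}$ and $\Delta^\delta f=(f_++f_--2f)/\delta^2$, with value $\Delta^\delta_\kappa f$ at $\kappa$; products and square roots are componentwise. A positive solution is one with values in $\mathcal P^\delta_{>0}=\{\rho:[N]\to\mathbb R:\rho_\kappa>0\ \forall\kappa,\ \delta\sum_\kappa\rho_\kappa=1\}$. *)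

(* Defs.v *)
From HB Require Import structures.
From mathcomp Require Import all_boot all_order all_algebra.
From mathcomp Require Import all_classical all_reals all_analysis.

Set Implicit Arguments.
Unset Strict Implicit.
Unset Printing Implicit Defensive.

Import Order.TTheory GRing.Theory Num.Theory.
Import numFieldNormedType.Exports.

Local Open Scope classical_set_scope.
Local Open Scope ring_scope.

(* Z/NZ is represented by 'I_N with the cyclic shifts ordS and ord_pred rather
   than by 'Z_N, which is Z/2Z when N = 1. *)
Definition shiftp (R : realType) (N : nat) (f : 'I_N -> R) : 'I_N -> R :=
  fun k => f (ordS k).

Definition shiftm (R : realType) (N : nat) (f : 'I_N -> R) : 'I_N -> R :=
  fun k => f (ord_pred k).

Definition dlaplacian (R : realType) (N : nat) (delta : R) (f : 'I_N -> R) :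
    'I_N -> R :=
  fun k => (shiftp f k + shiftm f k - 2 * f k) / delta ^+ 2.

Definition pos_density (R : realType) (N : nat) (delta : R) :
    set ('I_N -> R) :=
  [set rho | (forall k, 0 < rho k) /\ delta * \sum_(k < N) rho k = 1].

Definition dlss_rhs (R : realType) (N : nat) (delta : R) (rho : 'I_N -> R) :
    'I_N -> R :=
  fun k => - 2 * dlaplacian delta
    (fun j => (Num.sqrt (shiftp rho j * shiftm rho j) - rho j) / delta ^+ 2) k.

(* J is the time interval, of any shape. At an endpoint belonging to J, only
   one-sided continuity is asked; for nondegenerate J the equation holds there with
   one-sided derivatives, since dlss_rhs is continuous. *)
Definition positive_solution (R : realType) (N : nat) (delta : R)
    (J : interval R) (rho : R -> 'I_N -> R) : Prop :=
  [/\ forall t, t \in J -> pos_density delta (rho t),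
      forall k, {within [set` J], continuous (fun t => rho t k)} &
      forall t, interior [set` J] t -> forall k,
        is_derive t 1 (fun s => rho s k) (dlss_rhs delta (rho t) k)].

Definition hellinger (R : realType) (N : nat) (delta : R)
    (rho eta : 'I_N -> R) : R :=
  Num.sqrt (delta *
    \sum_(k < N) `|Num.sqrt (rho k) - Num.sqrt (eta k)| ^+ 2).

(* Main.v *)
Require Import Defs.
From HB Require Import structures.
From mathcomp Require Import all_boot all_order all_algebra.
From mathcomp Require Import all_classical all_reals all_analysis.
From mathcomp Require Import ring.

(** The squared Hellinger distance of two densities is [2 - 2 B], where
    [B = delta * \sum_k u k * v k] is their Bhattacharyya affinity and
    [u], [v] are the square roots of [rho], [eta]; so it suffices that [B] is
    non-decreasing.  With [A f k = f (k + 1) + f (k - 1)], the equation for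
    [u] factors, up to the positive factor [delta ^- 4], as
    [u' = - A (A u) + (A u)^2 / u] ([dlss_rhs_neighbours]), and likewise for
    [v].  As [A] is self-adjoint ([neighbours_adjoint]),
    [(\sum u v)' = \sum ((A u)^2 v / u + (A v)^2 u / v - 2 A u A v)],
    and each summand is the perfect square
    [(A u sqrt (v / u) - A v sqrt (u / v))^2]
    ([overlap_dissipation_ge0]).  At the ends of the time interval continuity
    replaces the derivative. *)

Set Implicit Arguments.
Unset Strict Implicit.
Unset Printing Implicit Defensive.

Import Order.TTheory GRing.Theory Num.Theory.
Import numFieldNormedType.Exports.

Local Open Scope classical_set_scope.
Local Open Scope ring_scope.

Definition neighbours (R : realType) (N : nat) (f : 'I_N -> R) : 'I_N -> R :=
  fun k => f (ordS k) + f (ord_pred k).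

Lemma neighbours_adjoint (R : realType) (N : nat) (f g : 'I_N -> R) :
  \sum_(k < N) neighbours f k * g k = \sum_(k < N) f k * neighbours g k.
Proof.
rewrite /neighbours; under eq_bigr do rewrite mulrDl.
under [RHS]eq_bigr do rewrite mulrDr.
rewrite !big_split /= addrC; congr (_ + _).
- rewrite (reindex_inj (can_inj (@ordSK N))) /=.
  by under eq_bigr do rewrite ordSK.
- rewrite (reindex_inj (can_inj (@ord_predK N))) /=.
  by under eq_bigr do rewrite ord_predK.
Qed.

(** Square roots turn the geometric means [sqrt (rho_+ rho_-)] into products,
    and the local terms of the two Laplacians then complete the square
    [(A u)^2]. *)
Lemma dlss_rhs_neighbours (R : realType) (N : nat) (delta : R)
    (rho : 'I_N -> R) (u : 'I_N -> R := fun k => Num.sqrt (rho k)) (k : 'I_N) :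
  (forall j, 0 <= rho j) ->
  dlss_rhs delta rho k =
    2 / delta ^+ 4 *
    (neighbours u k ^+ 2 - u k * neighbours (neighbours u) k).
Proof.
move=> rho0.
have u0 j : 0 <= u j by exact: sqrtr_ge0.
have sqE j : rho j = u j ^+ 2 by rewrite sqr_sqrtr.
clearbody u.
rewrite /dlss_rhs /dlaplacian /shiftp /shiftm /neighbours /=.
rewrite !ordSK !ord_predK.
rewrite !sqE -!exprMn !sqrtr_sqr !ger0_norm ?mulr_ge0//.
have -> : (delta ^+ 4)^-1 = (delta ^+ 2)^-1 ^+ 2 by rewrite exprVn -exprM.
by move: (delta ^+ 2)^-1 => c; ring.
Qed.

(** The sum is the derivative of [\sum u v] along two solutions.  It is not
    termwise nonnegative as it stands; summation by parts must first turn
    [v A (A u) + u A (A v)] into [2 A u A v]. *)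
Lemma overlap_dissipation_ge0 (R : realType) (N : nat) (delta : R)
    (rho eta : 'I_N -> R) :
  (forall k, 0 < rho k) -> (forall k, 0 < eta k) ->
  0 <= \sum_(k < N)
    (dlss_rhs delta rho k / (2 * Num.sqrt (rho k)) * Num.sqrt (eta k) +
     dlss_rhs delta eta k / (2 * Num.sqrt (eta k)) * Num.sqrt (rho k)).
Proof.
move=> rho0 eta0.
set u : 'I_N -> R := fun k => Num.sqrt (rho k).
set v : 'I_N -> R := fun k => Num.sqrt (eta k).
have u0 k : 0 < u k by rewrite sqrtr_gt0.
have v0 k : 0 < v k by rewrite sqrtr_gt0.
pose c : R := (delta ^+ 4)^-1.
pose Au := neighbours u; pose Av := neighbours v.
have c0 : 0 <= c by rewrite invr_ge0 exprn_even_ge0.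
rewrite (eq_bigr (fun k => c * (Au k ^+ 2 * v k / u k + Av k ^+ 2 * u k / v k)
    - c * (neighbours Au k * v k + neighbours Av k * u k))); last first.
  move=> k _; rewrite !dlss_rhs_neighbours; try by move=> j; apply: ltW.
  rewrite -/u -/v -/Au -/Av -/(u k) -/(v k) -/c.
  have : u k != 0 by rewrite gt_eqF.
  have : v k != 0 by rewrite gt_eqF.
  by move=> ? ?; field; apply/andP.
rewrite sumrB -!mulr_sumr -mulrBr mulr_ge0//.
rewrite (big_split _ _ _ (fun k => neighbours Au k * v k)) /=.
rewrite (neighbours_adjoint Au) (neighbours_adjoint Av) -big_split -sumrB /=.
apply: sumr_ge0 => k _; rewrite -/Au -/Av.
(* over the common denominator u v, the square roots in the perfect square
   disappear *)
have -> : Au k ^+ 2 * v k / u k + Av k ^+ 2 * u k / v k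
    - (Au k * Av k + Av k * Au k)
    = (Au k * v k - Av k * u k) ^+ 2 / (u k * v k).
  have : u k != 0 by rewrite gt_eqF.
  have : v k != 0 by rewrite gt_eqF.
  by move=> ? ?; field; apply/andP.
by rewrite divr_ge0 ?sqr_ge0// mulr_ge0 ?ltW.
Qed.

Definition overlap (R : realType) (N : nat) (rho eta : 'I_N -> R) : R :=
  \sum_(k < N) Num.sqrt (rho k) * Num.sqrt (eta k).

(** Unit mass makes the diagonal terms of the expanded square constant, so that
    the distance depends on the overlap alone, and decreasingly. *)
Lemma hellinger_overlap (R : realType) (N : nat) (delta : R)
    (rho eta : 'I_N -> R) :
  pos_density delta rho -> pos_density delta eta ->
  hellinger delta rho eta = Num.sqrt (2 - 2 * (delta * overlap rho eta)).
Proof.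
move=> [rho0 rho1] [eta0 eta1]; congr Num.sqrt.
rewrite (eq_bigr (fun k => rho k + eta k
    - 2 * (Num.sqrt (rho k) * Num.sqrt (eta k)))); last first.
  move=> k _; rewrite real_normK ?num_real// sqrrB !sqr_sqrtr ?ltW//.
  by rewrite mulr_natl addrAC.
by rewrite sumrB big_split/= -mulr_sumr mulrBr mulrDr rho1 eta1 /overlap; ring.
Qed.

Lemma within_continuous_overlap (R : realType) (N : nat) (A : set R)
    (rho eta : R -> 'I_N -> R) :
  (forall k, {within A, continuous (fun t => rho t k)}) ->
  (forall k, {within A, continuous (fun t => eta t k)}) ->
  {within A, continuous (fun t => overlap (rho t) (eta t))}.
Proof.
move=> crho ceta x; apply: cvg_big => [|k _]; first exact: add_continuous.
apply: cvgM; apply: continuous_comp; [exact: crho| |exact: ceta|];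
  exact: sqrt_continuous.
Qed.

Lemma is_derive_overlap (R : realType) (N : nat) (rho eta : R -> 'I_N -> R)
    (drho deta : 'I_N -> R) (t : R) :
  (forall k, 0 < rho t k) -> (forall k, 0 < eta t k) ->
  (forall k, is_derive t 1 (fun s => rho s k) (drho k)) ->
  (forall k, is_derive t 1 (fun s => eta s k) (deta k)) ->
  is_derive t 1 (fun s => overlap (rho s) (eta s))
    (\sum_(k < N) (drho k / (2 * Num.sqrt (rho t k)) * Num.sqrt (eta t k) +
                   deta k / (2 * Num.sqrt (eta t k)) * Num.sqrt (rho t k))).
Proof.
move=> rho0 eta0 drhoP detaP.
have sqrtP (f : R -> R) df : 0 < f t -> is_derive t 1 f df ->
    is_derive t 1 (fun s => Num.sqrt (f s)) (df / (2 * Num.sqrt (f t))).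
  move=> f0 fP; rewrite mulrC.
  exact: (@is_derive1_comp _ Num.sqrt f t _ _ (is_derive1_sqrt f0) fP).
have -> : (fun s => overlap (rho s) (eta s)) = \sum_(k < N)
    ((fun s => Num.sqrt (rho s k)) * (fun s => Num.sqrt (eta s k))).
  by apply/funext => s; rewrite fct_sumE.
apply: is_derive_sum => k.
apply: is_derive_eq.
  by apply: is_deriveM; apply: sqrtP.
by rewrite /= addrC /GRing.scale /=; congr (_ + _); exact: mulrC.
Qed.

Lemma positive_solution_overlap_nondecreasing (R : realType) (N : nat)
    (delta : R) (J : interval R) (rho eta : R -> 'I_N -> R) (s t : R) :
  positive_solution delta J rho -> positive_solution delta J eta ->
  s \in J -> t \in J -> s <= t ->
  overlap (rho s) (eta s) <= overlap (rho t) (eta t).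
Proof.
move=> [rhoD rhoC rhoE] [etaD etaC etaE] sJ tJ st.
have stJ : [set` `[s, t]] `<=` [set` J].
  move=> x /=; rewrite in_itv/= => /andP[sx xt].
  by apply: (@interval_is_interval _ J s t) => //; rewrite sx.
have intJ : `]s, t[ `<=` interior [set` J].
  rewrite -open_subsetE; last exact: interval_open.
  by apply: subset_trans stJ; exact: subset_itv_oo_cc.
have dB x : x \in `]s, t[ ->
    exists2 d, is_derive x 1 (fun r => overlap (rho r) (eta r)) d & 0 <= d.
  move=> xst; have xJ := intJ x xst.
  have [rho0 _] := rhoD x (interior_subset xJ).
  have [eta0 _] := etaD x (interior_subset xJ).
  have dP := is_derive_overlap rho0 eta0 (rhoE x xJ) (etaE x xJ).
  by eexists; [exact: dP|exact: overlap_dissipation_ge0].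
apply: (@ger0_derive1_le_cc _ (fun r => overlap (rho r) (eta r)) s t) => //.
- by move=> x /dB[d [dfx _] _].
- by move=> x /dB[d dfx d0]; rewrite derive1E derive_val.
- apply: within_continuous_overlap => k.
  + exact: (continuous_subspaceW stJ (rhoC k)).
  + exact: (continuous_subspaceW stJ (etaC k)).
- by rewrite in_itv/= lexx.
- by rewrite in_itv/= lexx andbT.
Qed.

Theorem lemma17 (R : realType) (N : nat) (hN : (0 < N)%N)
  (delta : R) (hdelta : delta = 1 / N%:R)
  (J : interval R) (rho eta : R -> 'I_N -> R)
  (hrho : positive_solution delta J rho)
  (heta : positive_solution delta J eta) :
  forall s t : R, s \in J -> t \in J -> s <= t ->
    hellinger delta (rho t) (eta t) <= hellinger delta (rho s) (eta s).
Proof.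
move=> s t sJ tJ st.
have delta0 : 0 <= delta by rewrite hdelta divr_ge0.
have [rhoD _ _] := hrho; have [etaD _ _] := heta.
rewrite !hellinger_overlap; try by [exact: rhoD|exact: etaD].
apply/ler_wsqrtr/lerB => //; rewrite ler_wpM2l// ler_wpM2l//.
exact: (positive_solution_overlap_nondecreasing hrho heta sJ tJ st).
Qed.
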